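(* Let $n\ge 9$ be an integer, and let $h$ and $h'$ be the integers attached to $n$ as in the context. If $9\le n\le 16$, then $h'=h$. If $n\ge 17$, then $h'<h$.
   Context: For a nonnegative integer $k$ let $\alpha(k)$ be the number of $1$'s in the binary expansion of $k$ ($\alpha(0)=0$). The Hurwitz–Radon number $h$ of $n$ is defined by: $h=4\ell$ if $n=8\ell+1$; $h=4\ell+1$ if $n=8\ell+2$; $h=4\ell+2$ if $n=8\ell+3$ or $8\ell+4$; $h=4\ell+3$ if $n=8\ell+5$, $8\ell+6$, $8\ell+7$ or $8\ell+8$. The integer $h'$ is defined as follows. - $s$ is the integer with $2^{s-1}<n\le 2^s$. - If $n<2^s-2$, $t$ is the integer with $2^s-2^t-1\le n<2^s-2^{t-1}-1$; if $n\in\{2^s-2,2^s-1,2^s\}$, then $t=1$. - $D=\{k\in\mathbb{Z}\mid k\le n,\ 2^s-k+1\le n,\ \alpha(k-1)\ge 2,\ \alpha(2^s-k)\ge 2\}$. - If $D\ne\emptyset$, let $m=\max D$, $m'=2^{s-t}(2^s-m)+1$, and $\varepsilon=0$ if $m'>n$, $\varepsilon=1$ if $m'\le n$. - $h'=s$ if $D=\emptyset$, and $h'=2s-t+\varepsilon$ if $D\neq\emptyset$. *)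

(* Defs.v *)
From Stdlib Require Import ZArith Lia Classical.
Open Scope Z_scope.

Fixpoint pos_ones (p : positive) : Z :=
  match p with
  | xH => 1
  | xO q => pos_ones q
  | xI q => 1 + pos_ones q
  end.

(* Only nonnegative arguments matter: for n <= 2 ^ s, the inequalities in
   [setD] force k - 1 >= 0 and 2 ^ s - k >= 0. *)
Definition alpha (k : Z) : Z :=
  match k with
  | Zpos p => pos_ones p
  | _ => 0
  end.

Definition is_hurwitz_radon (n h : Z) : Prop :=
  exists l : Z,
       (n = 8 * l + 1 /\ h = 4 * l)
    \/ (n = 8 * l + 2 /\ h = 4 * l + 1)
    \/ ((n = 8 * l + 3 \/ n = 8 * l + 4) /\ h = 4 * l + 2)
    \/ ((n = 8 * l + 5 \/ n = 8 * l + 6 \/ n = 8 * l + 7 \/ n = 8 * l + 8)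
        /\ h = 4 * l + 3).

(* [Z.pow] is 0 at negative exponents; for n >= 2 the conditions below still
   force s >= 1 and t >= 1. *)
Definition is_s (n s : Z) : Prop := 2 ^ (s - 1) < n <= 2 ^ s.

Definition is_t (n s t : Z) : Prop :=
     (n < 2 ^ s - 2 /\ 2 ^ s - 2 ^ t - 1 <= n < 2 ^ s - 2 ^ (t - 1) - 1)
  \/ ((n = 2 ^ s - 2 \/ n = 2 ^ s - 1 \/ n = 2 ^ s) /\ t = 1).

Definition setD (n s k : Z) : Prop :=
  k <= n /\ 2 ^ s - k + 1 <= n /\ 2 <= alpha (k - 1) /\ 2 <= alpha (2 ^ s - k).

Definition is_max (A : Z -> Prop) (m : Z) : Prop :=
  A m /\ forall k : Z, A k -> k <= m.

Definition m_prime (s t m : Z) : Z := 2 ^ (s - t) * (2 ^ s - m) + 1.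

Definition epsilon (n s t m : Z) : Z := if m_prime s t m <=? n then 1 else 0.

Definition is_h_prime (n h' : Z) : Prop :=
  exists s t : Z, is_s n s /\ is_t n s t /\
    (  ((forall k : Z, ~ setD n s k) /\ h' = s)
    \/ (exists m : Z, is_max (setD n s) m /\ h' = 2 * s - t + epsilon n s t m)).

Lemma hurwitz_radon_exists (n : Z) : exists h, is_hurwitz_radon n h.
Proof.
pose proof (Z.div_mod (n - 1) 8 ltac:(lia)) as E.
pose proof (Z.mod_pos_bound (n - 1) 8 ltac:(lia)) as B.
set (l := (n - 1) / 8) in *. set (r := (n - 1) mod 8) in *.
assert (C : r = 0 \/ r = 1 \/ 2 <= r <= 3 \/ 4 <= r) by lia.
destruct C as [C|[C|[C|C]]];
  [exists (4*l) | exists (4*l+1) | exists (4*l+2) | exists (4*l+3)];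
  exists l; lia.
Qed.

Lemma hurwitz_radon_unique (n h1 h2 : Z) :
  is_hurwitz_radon n h1 -> is_hurwitz_radon n h2 -> h1 = h2.
Proof. intros [l1 H1] [l2 H2]; lia. Qed.

Lemma is_s_ge1 (n s : Z) : 2 <= n -> is_s n s -> 1 <= s.
Proof.
intros Hn [_ H]. destruct (Z.lt_ge_cases s 0) as [L|L].
- rewrite (Z.pow_neg_r 2 s L) in H; lia.
- destruct (Z.eq_dec s 0) as [->|]; [simpl in H|]; lia.
Qed.

Lemma is_s_exists (n : Z) : 2 <= n -> exists s, is_s n s.
Proof.
intros Hn. exists (Z.log2_up n). unfold is_s.
rewrite Z.sub_1_r. apply Z.log2_up_spec. lia.
Qed.

Lemma is_s_unique (n s1 s2 : Z) : 2 <= n -> is_s n s1 -> is_s n s2 -> s1 = s2.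
Proof.
intros Hn H1 H2.
pose proof (is_s_ge1 n s1 Hn H1). pose proof (is_s_ge1 n s2 Hn H2).
unfold is_s in *; rewrite !Z.sub_1_r in *.
rewrite <- (Z.log2_up_unique n s1), <- (Z.log2_up_unique n s2); lia.
Qed.

Lemma is_t_exists (n s : Z) : is_s n s -> exists t, is_t n s t.
Proof.
intros [_ H]. destruct (Z.lt_ge_cases n (2 ^ s - 2)) as [L|L].
- exists (Z.log2_up (2 ^ s - 1 - n)). left.
  pose proof (Z.log2_up_spec (2 ^ s - 1 - n) ltac:(lia)) as B.
  rewrite Z.sub_1_r. lia.
- exists 1. right. lia.
Qed.

Lemma is_t_unique (n s t1 t2 : Z) : is_t n s t1 -> is_t n s t2 -> t1 = t2.
Proof.
assert (P : forall t, n < 2 ^ s - 2 ->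
   2 ^ s - 2 ^ t - 1 <= n < 2 ^ s - 2 ^ (t - 1) - 1 ->
   t = Z.log2_up (2 ^ s - 1 - n)).
{ intros t L B. symmetry. rewrite Z.sub_1_r in B.
  destruct (Z.le_gt_cases t 0) as [N|N].
  - assert (2 ^ t <= 2 ^ 0) by (apply Z.pow_le_mono_r; lia).
    simpl in *; lia.
  - apply Z.log2_up_unique; lia. }
intros [[L1 B1]|[L1 ->]] [[L2 B2]|[L2 ->]]; try lia.
rewrite (P t1), (P t2); trivial.
Qed.

Lemma max_exists (A : Z -> Prop) (b k : Z) :
  (forall j, A j -> j <= b) -> A k -> exists m, is_max A m.
Proof.
intros Hb. remember (Z.to_nat (b - k)) as d eqn:Ed. revert k Ed.
induction d as [d IH] using lt_wf_ind. intros k Ed Hk.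
destruct (classic (exists j, A j /\ k < j)) as [[j [Hj L]]|N].
- pose proof (Hb j Hj). apply (IH (Z.to_nat (b - j))) with j; trivial; lia.
- exists k. split; trivial. intros j Hj.
  destruct (Z.le_gt_cases j k) as [|G]; trivial.
  exfalso; apply N; exists j; split; trivial; lia.
Qed.

Lemma h_prime_exists (n : Z) : 2 <= n -> exists h', is_h_prime n h'.
Proof.
intros Hn. destruct (is_s_exists n Hn) as [s Hs].
destruct (is_t_exists n s Hs) as [t Ht].
destruct (classic (exists k, setD n s k)) as [[k Hk]|N].
- destruct (max_exists (setD n s) n k) as [m Hm]; trivial.
  { intros j [Hj _]; exact Hj. }
  exists (2 * s - t + epsilon n s t m), s, t. repeat split; try apply Hs; trivial.
  right. exists m. split; trivial.
- exists s, s, t. repeat split; try apply Hs; trivial.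
  left. split; trivial. intros k Hk; apply N; exists k; exact Hk.
Qed.

Lemma h_prime_unique (n h1 h2 : Z) :
  2 <= n -> is_h_prime n h1 -> is_h_prime n h2 -> h1 = h2.
Proof.
intros Hn (s1 & t1 & Hs1 & Ht1 & C1) (s2 & t2 & Hs2 & Ht2 & C2).
pose proof (is_s_unique n s1 s2 Hn Hs1 Hs2); subst s2.
pose proof (is_t_unique n s1 t1 t2 Ht1 Ht2); subst t2.
destruct C1 as [[N1 ->]|[m1 [[A1 M1] ->]]];
destruct C2 as [[N2 ->]|[m2 [[A2 M2] ->]]]; trivial.
- destruct (N1 m2 A2).
- destruct (N2 m1 A1).
- pose proof (M1 m2 A2). pose proof (M2 m1 A1).
  replace m2 with m1 by lia. reflexivity.
Qed.

(* Main.v *)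
(** Since [n > 2 ^ (s - 1)], the number [h >= (n - 2) / 2] grows exponentially
    in [s], while [h' <= 2 * s - t + 1 <= 2 * s] because [t >= 1]; this settles
    [s >= 6].  For [s = 5] the bound [h' <= 11 - t] with the exact value of [t]
    is needed only for [17 <= n <= 22], where [t = 4].  The cases
    [9 <= n <= 16] are a computation. *)

Require Import Defs.
From Stdlib Require Import ZArith Lia.
Open Scope Z_scope.

(** Equality occurs exactly at [n = 8 * l + 8]. *)
Lemma hurwitz_radon_lower (n h : Z) : is_hurwitz_radon n h -> n <= 2 * h + 2.
Proof. intros [l H]; lia. Qed.

Lemma is_t_ge1 (n s t : Z) : is_t n s t -> 1 <= t.
Proof.
intros [[L B] | [_ ->]]; [| lia].
destruct (Z.le_gt_cases t 0) as [N | N]; [| lia].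
(* This includes [t < 0], where [Z.pow] returns 0; then [2 ^ s - 2 ^ t - 1 <= n] contradicts
   [n < 2 ^ s - 2]. *)
assert (2 ^ t <= 2 ^ 0) by (apply Z.pow_le_mono_r; lia).
change (2 ^ 0) with 1 in *; lia.
Qed.

Lemma epsilon_bound (n s t m : Z) : 0 <= epsilon n s t m <= 1.
Proof. unfold epsilon; destruct (_ <=? _); lia. Qed.

(** Once [n] exceeds [4 * s + 2], [hurwitz_radon_lower] forces [h > 2 * s]. The induction starts
    from 26 < 32; at [s = 5] the inequality fails. *)
Lemma linear_lt_pow2 (s : Z) : 6 <= s -> 4 * s + 2 < 2 ^ (s - 1).
Proof.
intros Hs; pattern s; apply Zlt_lower_bound_ind with (z := 6); [| exact Hs].
intros x IH Hx; destruct (Z.eq_dec x 6) as [-> | N]; [reflexivity |].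
specialize (IH (x - 1) ltac:(lia)).
replace (x - 1) with (Z.succ (x - 1 - 1)) by lia.
rewrite Z.pow_succ_r by lia; lia.
Qed.

Lemma is_h_prime_empty (n s t : Z) :
  is_s n s -> is_t n s t -> (forall k, ~ setD n s k) -> is_h_prime n s.
Proof. intros Hs Ht N; exists s, t; auto. Qed.

Lemma is_h_prime_max (n s t m : Z) :
  is_s n s -> is_t n s t -> setD n s m -> (forall k, m < k -> ~ setD n s k) ->
  is_h_prime n (2 * s - t + epsilon n s t m).
Proof.
intros Hs Ht Hm N; exists s, t; split; [exact Hs | split; [exact Ht |]].
right; exists m; split; [split; [exact Hm |] | reflexivity].
intros k Hk; destruct (Z.le_gt_cases k m) as [| G]; [assumption |].
destruct (N k G Hk).
Qed.

Ltac arith_goal := unfold is_s, is_t, setD; simpl; lia.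

Ltac not_in_setD :=
  let k := fresh "k" in
  unfold setD; intros k; intros; intros (K1 & K2 & K3 & K4); change (2 ^ 4) with 16 in *;
  (* Over all the uses below, the range conditions leave at most 8, 9 (for [n = 9]), 12 (for
     [n = 12]) and 14, 15, 16 (for [n >= 14]). For each of them [k - 1] or [16 - k] has at most one
     binary digit 1. *)
  assert (k = 8 \/ k = 9 \/ k = 12 \/ k = 14 \/ k = 15 \/ k = 16) as C by lia;
  repeat destruct C as [C | C]; subst k; simpl in K3, K4; lia.

Lemma h_prime_le_16 (n h : Z) :
  9 <= n <= 16 -> is_hurwitz_radon n h -> is_h_prime n h.
Proof.
intros Hn [l H].
assert (C : n = 9 /\ h = 4 \/ n = 10 /\ h = 5 \/ n = 11 /\ h = 6 \/
  n = 12 /\ h = 6 \/ n = 13 /\ h = 7 \/ n = 14 /\ h = 7 \/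
  n = 15 /\ h = 7 \/ n = 16 /\ h = 7) by lia.
clear H Hn l; repeat destruct C as [C | C]; destruct C as [-> ->].
- apply (is_h_prime_empty 9 4 3); [arith_goal .. | not_in_setD].
(* From here on [m_prime] is 13, 21 or 25 and exceeds [n], so [epsilon] computes to 0 and
   [2 * s - t] is the tabulated [h]. *)
- apply (is_h_prime_max 10 4 3 10); [arith_goal .. | not_in_setD].
- apply (is_h_prime_max 11 4 2 11); [arith_goal .. | not_in_setD].
- apply (is_h_prime_max 12 4 2 11); [arith_goal .. | not_in_setD].
- apply (is_h_prime_max 13 4 1 13); [arith_goal .. | not_in_setD].
- apply (is_h_prime_max 14 4 1 13); [arith_goal .. | not_in_setD].
- apply (is_h_prime_max 15 4 1 13); [arith_goal .. | not_in_setD].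
- apply (is_h_prime_max 16 4 1 13); [arith_goal .. | not_in_setD].
Qed.

Lemma h_prime_upper (n h' : Z) :
  is_h_prime n h' ->
  exists s t, is_s n s /\ is_t n s t /\ 1 <= t /\
    (h' = s \/ h' <= 2 * s - t + 1).
Proof.
intros (s & t & Hs & Ht & C); exists s, t.
split; [exact Hs | split; [exact Ht | split; [exact (is_t_ge1 n s t Ht) |]]].
destruct C as [[_ ->] | (m & _ & ->)]; [left; reflexivity | right].
pose proof (epsilon_bound n s t m); lia.
Qed.

Lemma h_prime_lt_hurwitz_radon (n h h' : Z) :
  17 <= n -> is_hurwitz_radon n h -> is_h_prime n h' -> h' < h.
Proof.
intros Hn Hh Hh'.
pose proof (hurwitz_radon_lower n h Hh) as L.
destruct (h_prime_upper n h' Hh') as (s & t & Hs & Ht & T & B).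
destruct (Z.le_gt_cases 6 s) as [S | S].
- pose proof (linear_lt_pow2 s S); unfold is_s in Hs; lia.
- assert (s = 5) as ->.
  { destruct (Z.le_gt_cases s 4) as [N | N]; [| lia].
    assert (2 ^ s <= 2 ^ 4) by (apply Z.pow_le_mono_r; lia).
    unfold is_s in Hs; simpl in *; lia. }
  destruct Hh as [l H].
  (* For [s = 5], [t = 4] means [15 <= n < 23]; then [h' <= 7] while [h >= 8]. From 23 on, [h >= 11]
     beats [h' <= 10]. *)
  destruct (Z.le_gt_cases n 22) as [G | G]; [| lia].
  assert (t = 4) as -> by (apply (is_t_unique n 5); [exact Ht | arith_goal]).
  lia.
Qed.

Theorem proposition1p3 (n h h' : Z) (hn : 9 <= n)
  (Hh : is_hurwitz_radon n h) (Hh' : is_h_prime n h') :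
  (9 <= n <= 16 -> h' = h) /\ (17 <= n -> h' < h).
Proof.
split; intros Hn.
- apply (h_prime_unique n); [lia | exact Hh' | exact (h_prime_le_16 n h Hn Hh)].
- exact (h_prime_lt_hurwitz_radon n h h' Hn Hh Hh').
Qed.
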